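(* Let $k>s\ge 1$ be integers and let $n$ be an integer with $n>2k-s$. Let $\mathcal C=\{C\in\binom{[n]}{k}: |C\cap[k]|\ge s\}$. Then $$\max_{\mathcal A,\mathcal B}\bigl(|\mathcal A|+|\mathcal B|\bigr)=|\mathcal C|+1,$$ where the maximum is taken over all pairs of non-empty $s$-cross-intersecting families $\mathcal A,\mathcal B\subset\binom{[n]}{k}$.
   Context: For a positive integer $m$, $[m]=\{1,\ldots,m\}$, and $\binom{[n]}{k}$ denotes the collection of all $k$-element subsets of $[n]$. Two families $\mathcal A,\mathcal B$ of subsets of $[n]$ are called $s$-cross-intersecting if $|A\cap B|\ge s$ for all $A\in\mathcal A$ and $B\in\mathcal B$. *)

(* Defs.v *)
From mathcomp Require Import all_boot.

Set Implicit Arguments.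
Unset Strict Implicit.
Unset Printing Implicit Defensive.

(* The ground set [n] = {1, ..., n} is modelled by 'I_n = {0, ..., n-1}, so
   that the element j of [n] is the ordinal j-1. *)

Definition ksubsets (n k : nat) : {set {set 'I_n}} :=
  [set A : {set 'I_n} | #|A| == k].

(* This is all of 'I_n when n <= k. *)
Definition initial_set (n k : nat) : {set 'I_n} := [set i : 'I_n | i < k].

Definition cross_intersecting (n s : nat) (A B : {set {set 'I_n}}) : bool :=
  [forall X in A, forall Y in B, s <= #|X :&: Y|].

Definition familyC (n k s : nat) : {set {set 'I_n}} :=
  [set X in ksubsets n k | s <= #|X :&: initial_set n k|].

Definition admissible (n k s : nat) (A B : {set {set 'I_n}}) : bool :=
  [&& A \subset ksubsets n k, B \subset ksubsets n k,
      A != set0, B != set0 & cross_intersecting s A B].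

(* Main.v *)
(** Among the pairs [(A, B)] maximizing [#|A| + #|B|], take one with [#|A|]
    minimal; by symmetry [#|A| <= #|B|].  For a transposition [t] of the ground
    set, the pairs [(A :&: tA, B :|: tB)] and [(A :|: tA, B :&: tB)] are again
    cross-intersecting and their sizes add up to twice the maximum, so that
    minimality forces [tA = A] as soon as [A] meets [tA].  In other words, [A]
    is a block of the action of the symmetric group on the [k]-sets.  This
    action being primitive up to complementation, [A] is a singleton, a pair of
    complementary sets, or the family of all [k]-sets; the last case is excluded
    by [n > 2k - s], and the bound is immediate in the first two. *)
Require Import Defs.
From mathcomp Require Import all_boot all_fingroup.
From mathcomp Require Import zify.

Set Implicit Arguments.
Unset Strict Implicit.
Unset Printing Implicit Defensive.

(** * Transpositions acting on sets of points *)

Section Swap.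
Variable T : finType.
Implicit Types (a b c : T) (X Y Z W : {set T}) (F : {set {set T}}).

Definition swap a b X : {set T} := tperm a b @: X.

Lemma mem_swap a b X c : (c \in swap a b X) = (tperm a b c \in X).
Proof. by rewrite -[c in LHS](tpermK a b) mem_imset //; apply: perm_inj. Qed.

Lemma swapK a b : involutive (swap a b).
Proof. by move=> X; apply/setP=> c; rewrite !mem_swap tpermK. Qed.

Lemma swap_inj a b : injective (swap a b).
Proof. exact: can_inj (swapK a b). Qed.

Lemma swapC a b X : swap a b X = swap b a X.
Proof. by rewrite /swap tpermC. Qed.

Lemma card_swap a b X : #|swap a b X| = #|X|.
Proof. by rewrite card_imset //; apply: perm_inj. Qed.

Lemma swapI a b X Y : swap a b (X :&: Y) = swap a b X :&: swap a b Y.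
Proof. by apply/setP=> c; rewrite inE !mem_swap inE. Qed.

Lemma swap_id a b X : (a \in X) = (b \in X) -> swap a b X = X.
Proof.
by move=> eq_ab; apply/setP=> c; rewrite mem_swap; case: tpermP => [->|->|].
Qed.

Lemma swap_conj a b c X : a != c -> b != c ->
  swap a b (swap b c (swap a b X)) = swap a c X.
Proof.
move=> neq_ac neq_bc; apply/setP=> d; rewrite !mem_swap.
suff -> : tperm a b (tperm b c (tperm a b d)) = tperm a c d by [].
by rewrite -permJ tpermK tpermJ tpermR [tperm a b c]tpermD.
Qed.

(** Induction on [#|X :\: Y|]: exchanging a point of [X :\: Y] with one of [Y :\: X] keeps the size
    and brings [X] closer to [Y]. *)
Lemma swap_closed_full F X Y :
    (forall a b Z, Z \in F -> swap a b Z \in F) ->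
  X \in F -> #|X| = #|Y| -> Y \in F.
Proof.
move=> Fswap; have [m] := ubnP #|X :\: Y|.
elim: m X => // m IHm X ltXm FX eqXY.
have [XsubY | /subsetPn[a Xa Y'a]] := boolP (X \subset Y).
  suff <- : X = Y by [].
  by apply/eqP; rewrite eqEcard XsubY eqXY leqnn.
have /subsetPn[b Yb X'b] : ~~ (Y \subset X).
  apply: contra Y'a => YsubX; suff -> : Y = X by [].
  by apply/eqP; rewrite eqEcard YsubX eqXY leqnn.
apply: (IHm (swap a b X)); rewrite ?card_swap //; last exact: Fswap.
rewrite ltnS in ltXm; apply: leq_trans ltXm.
apply: proper_card; apply/properP; split.
  apply/subsetP=> c; rewrite !inE mem_swap.
  by case: tpermP => [->|->|//]; rewrite ?(negPf X'b) ?andbF // Yb.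
by exists a; rewrite !inE ?mem_swap ?tpermL ?Xa ?(negPf X'b) ?Y'a.
Qed.

(* Primitivity, up to complementation, of the action of the symmetric group on
   the sets of a given size: [F] is a block containing [X] and [Y]. *)
Lemma swap_block_full F X Y Z :
    (forall a b W, W \in F -> swap a b W \in F ->
       forall Z, Z \in F -> swap a b Z \in F) ->
    X \in F -> Y \in F -> #|X| = #|Y| -> Y != X -> Y != ~: X ->
  #|X| = #|Z| -> Z \in F.
Proof.
move=> Fblock FX FY eqXY neqYX neqYCX.
(* This is an equivalence relation on points; the aim is to show that it has a single class, so that
   [F] is closed under all swaps. *)
pose inv a b := forall W, W \in F -> swap a b W \in F.
have invC a b : inv a b -> inv b a.
  by move=> Pab W FW; rewrite swapC; apply: Pab.
have invT b a c : inv a b -> inv b c -> inv a c.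
  move=> Pab Pbc; have [<- //|neq_bc] := eqVneq b c.
  have [<- W FW|neq_ac] := eqVneq a c; first by rewrite swap_id.
  by move=> W FW; rewrite -(swap_conj _ neq_ac neq_bc); apply/Pab/Pbc/Pab.
have inv_mem W a b : W \in F -> (a \in W) = (b \in W) -> inv a b.
  by move=> FW eq_ab; apply: (Fblock _ _ W); rewrite ?swap_id.
have [u Yu X'u] : exists2 u, u \in Y & u \notin X.
  apply/subsetPn; apply: contra neqYX => YsubX.
  by rewrite eqEcard YsubX eqXY leqnn.
have [v Xv Y'v] : exists2 v, v \in X & v \notin Y.
  apply/subsetPn; apply: contra neqYX => XsubY.
  by rewrite eq_sym eqEcard XsubY eqXY leqnn.
(* By [inv_mem], points on the same side of [X], or of [Y], are related. As [Y] is not the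
   complement of [X], some [w] is in both or in neither; paired with [u] or [v], it links the two
   sides of [X]. *)
have [p [q [Xp X'q Ppq]]] : exists p q, [/\ p \in X, q \notin X & inv p q].
  have [/existsP[w /eqP eq_w]|] := boolP [exists w, (w \in X) == (w \in Y)].
    have [Xw|X'w] := boolP (w \in X).
      by exists w, u; split=> //; apply: (inv_mem Y); rewrite // -eq_w Xw Yu.
    exists v, w; split=> //; apply: (inv_mem Y) => //.
    by rewrite -eq_w (negPf X'w) (negPf Y'v).
  rewrite negb_exists => /forallP neqXY; case/eqP: neqYCX; apply/setP=> w.
  by have := neqXY w; rewrite inE; do 2!case: (_ \in _).
have Pp a : inv a p.
  have [Xa|X'a] := boolP (a \in X); first by apply: (inv_mem X); rewrite // Xa.
  apply: (invT q); last exact: invC.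
  by apply: (inv_mem X); rewrite // (negPf X'a) (negPf X'q).
apply: swap_closed_full => // a b.
by apply: (invT p); [|apply: invC]; apply: Pp.
Qed.

End Swap.

(** * Admissible pairs and counts of intersecting sets *)

Section CrossIntersecting.
Variables (n k s : nat).
Implicit Types (A B : {set {set 'I_n}}) (X Y Z W : {set 'I_n}).

Lemma admissibleP A B :
  reflect [/\ forall X, X \in A -> #|X| = k, forall Y, Y \in B -> #|Y| = k,
              A != set0, B != set0
            & forall X Y, X \in A -> Y \in B -> s <= #|X :&: Y|]
          (admissible k s A B).
Proof.
apply: (iffP and5P) => [[/subsetP Ak /subsetP Bk A0 B0 /forall_inP AB]|].
  split=> // [X /Ak|Y /Bk|X Y AX BY]; rewrite ?inE; try by move/eqP.
  by have /forall_inP := AB X AX; apply.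
case=> Ak Bk A0 B0 AB; split=> //.
- by apply/subsetP=> X /Ak <-; rewrite inE.
- by apply/subsetP=> X /Bk <-; rewrite inE.
- by apply/forall_inP=> X AX; apply/forall_inP=> Y; apply: AB.
Qed.

Lemma admissibleC A B : admissible k s A B -> admissible k s B A.
Proof.
case/admissibleP=> Ak Bk A0 B0 AB; apply/admissibleP; split=> // X Y BX AY.
by rewrite setIC; apply: AB.
Qed.

Lemma admissible_swap a b A B :
  admissible k s A B -> admissible k s (swap a b @: A) (swap a b @: B).
Proof.
case/admissibleP=> Ak Bk A0 B0 AB; apply/admissibleP.
split; rewrite -?card_gt0 ?card_imset ?card_gt0 //; try exact: swap_inj.
- by move=> _ /imsetP[X AX ->]; rewrite card_swap Ak.
- by move=> _ /imsetP[X BX ->]; rewrite card_swap Bk.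
move=> _ _ /imsetP[X AX ->] /imsetP[Y BY ->].
by rewrite -swapI card_swap AB.
Qed.

Lemma admissibleIU A B A' B' :
    admissible k s A B -> admissible k s A' B' -> A :&: A' != set0 ->
  admissible k s (A :&: A') (B :|: B').
Proof.
case/admissibleP=> Ak Bk A0 B0 AB; case/admissibleP=> Ak' Bk' _ _ AB' AA'0.
apply/admissibleP; split=> //.
- by move=> X /setIP[/Ak].
- by move=> X /setUP[/Bk|/Bk'].
- by case/set0Pn: B0 => Y BY; apply/set0Pn; exists Y; rewrite inE BY.
by move=> X Y /setIP[AX A'X] /setUP[BY|B'Y]; [apply: AB | apply: AB'].
Qed.

(** Take [Z] with minimal intersection. If it met [Y] in at least [s] points, the union would have
    at most [2 * k - s] points, and swapping a common point with one outside the union would do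
    better. *)
Lemma exists_small_intersection Y : 0 < s <= k -> 2 * k - s < n -> #|Y| = k ->
  exists2 Z : {set 'I_n}, #|Z| = k & #|Z :&: Y| < s.
Proof.
move=> /andP[s_gt0 le_sk] ltn Yk.
have PY : #|Y| == k by rewrite Yk.
have [Z /eqP Zk Zmin] :=
  @arg_minnP _ Y (fun Z => #|Z| == k) (fun Z => #|Z :&: Y|) PY.
exists Z => //; rewrite ltnNge; apply/negP=> le_s.
have /set0Pn[a /setIP[Za Ya]] : Z :&: Y != set0.
  by rewrite -card_gt0; apply: leq_trans le_s.
have /set0Pn[b] : ~: (Z :|: Y) != set0.
  have := cardsUI Z Y; have := cardsC (Z :|: Y).
  by rewrite -card_gt0 card_ord; lia.
rewrite !inE negb_or => /andP[Z'b Y'b].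
have := Zmin (swap a b Z); rewrite card_swap Zk eqxx => /(_ isT).
rewrite leqNgt => /negP; apply.
apply: proper_card; apply/properP; split.
  apply/subsetP=> c; rewrite !inE mem_swap.
  by case: tpermP => [->|->|//]; rewrite ?(negPf Z'b) // (negPf Y'b) andbF.
by exists a; rewrite !inE ?mem_swap ?tpermL ?Za ?Ya ?(negPf Z'b).
Qed.

Lemma card_initial_set : k <= n -> #|initial_set n k| = k.
Proof.
move=> le_kn; have -> : initial_set n k = widen_ord le_kn @: setT.
  apply/setP=> i; rewrite inE; apply/idP/imsetP => [lt_ik|[j _ ->]].
    by exists (Ordinal lt_ik) => //; apply: val_inj.
  exact: ltn_ord j.
rewrite card_imset ?cardsT ?card_ord // => i j /(congr1 val) eq_ij.
exact: val_inj.
Qed.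

(** The count is invariant under swaps of the fixed set, so it can be read off at
    [initial_set n k]. *)
Lemma card_large_intersection X : k <= n -> #|X| = k ->
  #|[set Y in ksubsets n k | s <= #|X :&: Y|]| = #|familyC n k s|.
Proof.
move=> le_kn Xk.
pose F := [set Z : {set 'I_n} |
  #|[set Y in ksubsets n k | s <= #|Z :&: Y|]| == #|familyC n k s|].
suff : X \in F by rewrite inE => /eqP.
apply: (@swap_closed_full _ _ (initial_set n k)); last first.
- by rewrite card_initial_set.
- by rewrite inE; apply/eqP/eq_card=> Y; rewrite !inE setIC.
move=> a b Z; rewrite !inE => /eqP <-.
rewrite -[eqbRHS](card_imset _ (@swap_inj _ a b)); apply/eqP/eq_card => Y.
rewrite -[Y in RHS](swapK a b) (mem_imset _ _ (@swap_inj _ a b)).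
by rewrite !inE card_swap -(card_swap a b (_ :&: _)) swapI swapK.
Qed.

(** * Pairs of maximal total size with smallest first family *)

Section Extremal.
Variables A B : {set {set 'I_n}}.
Hypothesis admAB : admissible k s A B.
Hypothesis maxAB : forall A' B', admissible k s A' B' ->
  #|A'| + #|B'| <= #|A| + #|B|.
Hypothesis minA : forall A' B', admissible k s A' B' ->
  #|A'| + #|B'| = #|A| + #|B| -> #|A| <= #|A'|.

Lemma extremal_block a b W : W \in A -> swap a b W \in A ->
  forall Z, Z \in A -> swap a b Z \in A.
Proof.
move=> AW AabW; set A' := swap a b @: A; set B' := swap a b @: B.
have admAB' : admissible k s A' B' by apply: admissible_swap.
have cardA' : #|A'| = #|A| by rewrite card_imset //; apply: swap_inj.
have cardB' : #|B'| = #|B| by rewrite card_imset //; apply: swap_inj.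
have AI0 : A :&: A' != set0.
  by apply/set0Pn; exists (swap a b W); rewrite inE AabW imset_f.
have admIU := admissibleIU admAB admAB' AI0.
have leAB : #|A| <= #|B|.
  by apply: minA (admissibleC admAB) _; rewrite addnC.
have := cardsUI A A'; rewrite cardA' => cardAUI.
have := cardsUI B B'; rewrite cardB' => cardBUI.
have maxIU := maxAB admIU.
(* Maximality gives [#|B :|: B'| <= #|A| + #|B| - #|A :&: A'|], so [#|B :&: B'|] is at least
   [#|B| - #|A| + #|A :&: A'|], which is positive. *)
have BI0 : B :&: B' != set0.
  have AI_gt0 : 0 < #|A :&: A'| by rewrite card_gt0.
  by rewrite -card_gt0; lia.
have admUI : admissible k s (A :|: A') (B :&: B').
  by apply/admissibleC/admissibleIU => //; apply: admissibleC.
have maxUI := maxAB admUI.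
(* The two new pairs have total size twice the maximum, so each attains it and minimality applies to
   the first. *)
have leAI : #|A| <= #|A :&: A'| by apply: minA admIU _; lia.
have /eqP AIA : A :&: A' == A by rewrite eqEcard subsetIl leAI.
move=> Z; rewrite -{1}AIA inE => /andP[_ /imsetP[Y AY ->]].
by rewrite swapK.
Qed.

Lemma extremal_card_le : 0 < s <= k -> 2 * k - s < n ->
  #|A| + #|B| <= #|familyC n k s| + 1.
Proof.
move=> sk ltn; have /andP[s_gt0 le_sk] := sk; have le_kn : k <= n by lia.
have [Ak Bk A0 B0 AB] := admissibleP _ _ admAB.
have [X AX] := set0Pn _ A0; have Xk := Ak X AX.
pose BX := [set Y in ksubsets n k | s <= #|X :&: Y|].
rewrite -(card_large_intersection le_kn Xk) -/BX.
have BsubBX : B \subset BX.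
  by apply/subsetP=> Y BY; rewrite !inE Bk // eqxx AB.
(* Any other member would force [A] to contain all [k]-sets, including some [Z] that meets a member
   of [B] in fewer than [s] points. *)
have AsubX : A \subset [set X; ~: X].
  apply/subsetP=> Y AY; rewrite !inE; apply: contraT.
  rewrite negb_or => /andP[neqYX neqYCX].
  have [Y0 BY0] := set0Pn _ B0.
  have [Z Zk] := exists_small_intersection sk ltn (Bk _ BY0).
  rewrite ltnNge AB //.
  by apply: (swap_block_full extremal_block AX AY); rewrite ?Xk ?Zk ?(Ak _ AY).
have [AXC|A'XC] := boolP (~: X \in A).
  (* [X] is disjoint from [~: X], hence missing from [B]; this loss pays for the second member of
     [A]. *)
  have ltB : #|B| < #|BX|.
    apply: proper_card; apply/properP; split=> //; exists X.
      by rewrite !inE setIid Xk eqxx.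
    apply/negP=> BX'; have := AB _ _ AXC BX'.
    by rewrite setIC setICr cards0 leqNgt s_gt0.
  have leA : #|A| <= 2.
    by rewrite (leq_trans (subset_leq_card AsubX)) // cards2 ltnS leq_b1.
  by have := leq_add leA ltB; rewrite addnS add2n ltnS addn1.
have leA : #|A| <= 1.
  rewrite -(cards1 X); apply: subset_leq_card.
  apply/subsetP=> Y AY; have := subsetP AsubX Y AY; rewrite !inE.
  by case/orP=> // /eqP eqY; rewrite -eqY AY in A'XC.
by rewrite addnC; apply: leq_add leA; apply: subset_leq_card.
Qed.

End Extremal.

End CrossIntersecting.

Theorem theorem3 (n k s : nat) (hs : 1 <= s) (hsk : s < k)
    (hn : 2 * k - s < n) :
  \max_(P : {set {set 'I_n}} * {set {set 'I_n}} | admissible k s P.1 P.2)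
     (#|P.1| + #|P.2|) = #|familyC n k s| + 1.
Proof.
have le_kn : k <= n by lia.
have Kk := card_initial_set le_kn; set K := initial_set n k in Kk.
pose adm (P : {set {set 'I_n}} * {set {set 'I_n}}) := admissible k s P.1 P.2.
pose sz (P : {set {set 'I_n}} * {set {set 'I_n}}) := #|P.1| + #|P.2|.
(* This pair attains the bound, and also shows that there is a pair to maximize over. *)
have admKC : adm ([set K], familyC n k s).
  apply/admissibleP; split=> /=.
  - by move=> X /set1P->.
  - by move=> X; rewrite !inE => /andP[/eqP].
  - by apply/set0Pn; exists K; rewrite inE.
  - by apply/set0Pn; exists K; rewrite !inE setIid Kk eqxx ltnW.
  by move=> X Y /set1P-> ; rewrite !inE setIC => /andP[].
apply/eqP; rewrite eqn_leq; apply/andP; split; last first.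
  by rewrite addnC -(cards1 K); apply: (bigmax_sup ([set K], familyC n k s)).
have [P0 admP0 maxP0] := @arg_maxnP _ _ adm sz admKC.
have P0ok : adm P0 && (sz P0 == sz P0) by rewrite eqxx andbT.
have [P /andP[admP /eqP szP] minP] :=
  @arg_minnP _ P0 (fun P => adm P && (sz P == sz P0)) (fun P => #|P.1|) P0ok.
apply/bigmax_leqP => Q admQ; apply: leq_trans (maxP0 Q admQ) _; rewrite /= -szP.
apply: extremal_card_le admP _ _ _ hn; last by rewrite hs ltnW.
  by move=> A' B' adm'; rewrite -/(sz P) szP; apply: (maxP0 (A', B') adm').
move=> A' B' adm' eq_sz; apply: (minP (A', B')); apply/andP; split=> //.
by rewrite -szP; apply/eqP.
Qed.
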